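(* For positive integers $d\le n$ and $k\le n$, vectors $\bm a_1,\dots,\bm a_n\in\mathbb{R}^d$ and $\lambda>0$, let $$z_k:=\min_{S\subseteq [n]}\left\{\operatorname{tr}\left(\left(\sum_{i\in S}\bm a_i\bm a_i^{\top}+\lambda \bm I_d\right)^{-1}\right): |S|=k\right\},$$ $$\nu_k^{\mathrm C}:=\min_{\bm x\in[0,1]^n}\left\{\operatorname{tr}\left(\left(\sum_{i\in[n]}x_i\bm a_i\bm a_i^{\top}+\lambda \bm I_d\right)^{-1}\right): \sum_{i\in[n]}x_i=k\right\}.$$ The following hold. (i) For any $k\in[d,n]$, $$1\le \frac{z_k}{\nu_k^{\mathrm C}}\le\frac{n-d+1}{k-d+1}.$$ (ii) For $k\in[d-1]$, there is an instance of the problem (an integer $n\ge d$ and vectors $\bm a_1,\dots,\bm a_n\in\mathbb{R}^d$) for which $z_k/\nu_k^{\mathrm C}\to\infty$ as $\lambda\to 0$ (with $\lambda>0$).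
   Context: For positive integers $s\le n$, $[n]=\{1,\dots,n\}$ and $[s,n]=\{s,s+1,\dots,n\}$ (sets of integers); the constraint $\bm x\in[0,1]^n$ uses the real unit interval. $\bm I_d$ is the $d\times d$ identity matrix. *)

(* Defs.v *)
From mathcomp Require Import all_boot all_order all_algebra.
From mathcomp Require Import all_classical all_reals all_analysis.

Set Implicit Arguments.
Unset Strict Implicit.
Unset Printing Implicit Defensive.

Import Order.TTheory GRing.Theory Num.Theory.
Import numFieldNormedType.Exports.

Local Open Scope classical_set_scope.
Local Open Scope ring_scope.

(* The least element of A, not merely its infimum: the junk value 0 is returned
   whenever A has no least element, even if A is bounded below. *)
Definition minimum (R : realType) (A : set R) : R :=
  xget 0 [set m | A m /\ lbound A m].

Section Values.
Variables (R : realType) (d n : nat).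
Implicit Types (a : 'I_n -> 'cV[R]_d) (lambda : R) (k : nat).

Definition zk a lambda k : R :=
  minimum [set \tr (invmx (\sum_(i in S) a i *m (a i)^T + lambda%:M))
          | S in [set S : {set 'I_n} | #|S| = k]].

Definition nukC a lambda k : R :=
  minimum [set \tr (invmx (\sum_(i < n) x 0 i *: (a i *m (a i)^T) + lambda%:M))
          | x in [set x : 'rV[R]_n |
              (forall i, 0 <= x 0 i <= 1) /\ \sum_(i < n) x 0 i = k%:R]].

End Values.

(* Main.v *)
(* Since x <= 1 entrywise, the relaxation is bounded below by the value
   tr ((sum_(i in [n]) a_i a_i^T + lambda I)^-1) of the full design.  Starting from the
   full design, indices are removed one at a time: averaging the Sherman-Morrison
   formula over the m current indices with weights 1 - a_i^T M^-1 a_i, where M is the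
   current regularized matrix, shows that some removal increases the trace of the
   inverse by a factor of at most (m - d + 1) / (m - d), and these factors telescope
   to (n - d + 1) / (k - d + 1).
   For (ii) take n = d and the standard basis: any S with |S| < d leaves an eigenvalue
   lambda, so z_k >= 1 / lambda, whereas x_i = k / d keeps the relaxation below d^2 / k. *)
Require Import Defs.
From mathcomp Require Import all_boot all_order all_algebra.
From mathcomp Require Import all_classical all_reals all_analysis.
From mathcomp Require Import perm ring lra.
Import Order.TTheory GRing.Theory Num.Theory.
Import numFieldNormedType.Exports.
Local Open Scope classical_set_scope.
Local Open Scope ring_scope.

(** * Positive definite matrices and rank-one updates of their inverses *)

Section PositiveDefinite.
Context {R : realFieldType} {d : nat}.
Implicit Types (M : 'M[R]_d) (v w : 'cV[R]_d).

(** The quadratic form at [v] is written as the trace of [M v v^T], the shape in which leverages and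
    dyad sums appear later. *)
Definition posdef M := M^T = M /\ forall v, v != 0 -> 0 < \tr (M *m (v *m v^T)).

Lemma mxtrace_dyad M v w : \tr (M *m (v *m w^T)) = (w^T *m M *m v) 0 0.
Proof. by rewrite mulmxA mxtrace_mulC mulmxA trace_mx11. Qed.

Lemma dyad_ge0 v w : 0 <= \tr (v *m v^T *m (w *m w^T)).
Proof.
rewrite mxtrace_dyad mulmxA -mulmxA.
have -> : v^T *m w = (w^T *m v)^T by rewrite trmx_mul trmxK.
by rewrite mxE big_ord1 [X in _ * X]mxE sqr_ge0.
Qed.

Lemma posdef_ge0 {M} v : posdef M -> 0 <= \tr (M *m (v *m v^T)).
Proof.
move=> [_ Mpos]; have [->|/Mpos /ltW//] := eqVneq v 0.
by rewrite mul0mx mulmx0 mxtrace0.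
Qed.

Lemma posdef_unit {M} : posdef M -> M \in unitmx.
Proof.
move=> [_ Mpos]; rewrite -row_free_unit -kermx_eq0.
apply: contraT => /rowV0Pn[v /sub_kermxP vM v0].
have := Mpos v^T; rewrite trmx_eq0 => /(_ v0).
by rewrite mxtrace_dyad trmxK vM mul0mx mxE ltxx.
Qed.

(** Substituting [v = M w] turns the form of [invmx M] at [v] into the form of [M] at [w]. *)
Lemma posdef_inv {M} : posdef M -> posdef (invmx M).
Proof.
move=> Mpd; have [Msym Mpos] := Mpd; have Mu := posdef_unit Mpd.
have Vsym : (invmx M)^T = invmx M by rewrite trmx_inv Msym.
split=> // v v0; have w0 : invmx M *m v != 0.
  by apply: contraNneq v0 => w0; rewrite -(mulKVmx Mu v) w0 mulmx0.
have := Mpos _ w0; rewrite !mxtrace_dyad trmx_mul Vsym.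
by rewrite -[_ *m invmx M *m M]mulmxA mulVmx // mulmx1 mulmxA.
Qed.

Lemma posdef_scalar (lambda : R) : 0 < lambda -> posdef lambda%:M.
Proof.
move=> l0; split=> [|v v0]; first by rewrite tr_scalar_mx.
rewrite mul_scalar_mx mxtraceZ mulr_gt0 // mxtrace_mulC trace_mx11 mxE.
have sq_ge0 i : true -> 0 <= v^T 0 i * v i 0 by rewrite mxE sqr_ge0.
rewrite lt0r sumr_ge0 // andbT psumr_eq0 //; apply: contraNN v0 => /allP v0.
apply/eqP/matrixP => i j; rewrite ord1 mxE; apply/eqP.
by have := v0 i (mem_index_enum _); rewrite /= mxE mulf_eq0 orbb.
Qed.

Lemma posdef_add_dyad {M} v {c : R} : 0 <= c -> posdef M -> posdef (M + c *: (v *m v^T)).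
Proof.
move=> c0 [Msym Mpos]; split=> [|w w0].
  by rewrite linearD linearZ /= trmx_mul trmxK Msym.
by rewrite mulmxDl mxtraceD -scalemxAl mxtraceZ ltr_wpDr ?Mpos// mulr_ge0// dyad_ge0.
Qed.

Lemma posdef_add_dyads (I : Type) (r : seq I) (P : pred I) (a : I -> 'cV[R]_d) (c : I -> R) M :
  (forall i, P i -> 0 <= c i) -> posdef M ->
  posdef (M + \sum_(i <- r | P i) c i *: (a i *m (a i)^T)).
Proof.
move=> c0 Mpd; elim: r => [|i r IHr]; first by rewrite big_nil addr0.
rewrite big_cons; case: ifP => // Pi.
by rewrite addrCA addrC; apply: posdef_add_dyad; rewrite ?c0.
Qed.

Lemma mxtrace_posdef_gt0 {M} : (0 < d)%N -> posdef M -> 0 < \tr M.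
Proof.
move=> d0 [_ Mpos]; have diag_gt0 i : 0 < M i i.
  have := Mpos (delta_mx i 0); rewrite mxtrace_dyad trmx_delta -rowE -colE !mxE.
  by apply; apply/eqP => /matrixP/(_ i 0)/eqP; rewrite !mxE !eqxx oner_eq0.
rewrite /mxtrace (bigD1 (Ordinal d0)) //= ltr_wpDr ?diag_gt0 //.
by apply: sumr_ge0 => i _; exact: ltW.
Qed.

(** The candidate inverse is checked by multiplication. A signed [c] covers both adding a dyad and,
    with [c = -1], removing one. *)
Lemma sherman_morrison M v (c : R) : M \in unitmx ->
  1 + c * \tr (invmx M *m (v *m v^T)) != 0 ->
  invmx (M + c *: (v *m v^T)) = invmx M -
    (c / (1 + c * \tr (invmx M *m (v *m v^T)))) *: (invmx M *m (v *m v^T) *m invmx M).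
Proof.
move=> Mu; set s := \tr _ => s0; set N := invmx M.
suff E : (M + c *: (v *m v^T)) *m (N - (c / (1 + c * s)) *: (N *m (v *m v^T) *m N)) = 1%:M.
  have [U _] := mulmx1_unit E.
  by rewrite -[RHS](mulKmx U) E mulmx1.
have vNv : v^T *m N *m v = s%:M by rewrite [LHS]mx11_scalar /s mxtrace_dyad.
have vvN : v *m v^T *m (N *m (v *m v^T) *m N) = s *: (v *m v^T *m N).
  rewrite !mulmxA -(mulmxA v) -(mulmxA v) vNv.
  by rewrite mul_mx_scalar -!scalemxAl mulmxA.
(* This is the total coefficient of [v v^T N] in the expanded product. *)
have : - (c / (1 + c * s)) + (c - c / (1 + c * s) * (c * s)) = 0 by field.
move: (c / _) => g g0.
rewrite mulmxDl !mulmxBr mulmxV // -!scalemxAr -!scalemxAl.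
rewrite [M *m (_ *m _ *m _)]mulmxA [M *m (_ *m _)]mulKVmx // vvN.
rewrite -addrA -[RHS]addr0; congr (_ + _).
by rewrite -!scaleNr !scalerA -!scalerDl -[_ * c * s]mulrA mulNr g0 scale0r.
Qed.

End PositiveDefinite.

(** * Traces of inverses under rank-one updates, and leverages *)

Section TraceOfInverse.
Context {R : realFieldType} {d : nat}.
Implicit Types (M : 'M[R]_d) (v : 'cV[R]_d).

Lemma mxtrace_mul_tr_ge0 {m n : nat} (A : 'M[R]_(m, n)) : 0 <= \tr (A *m A^T).
Proof.
apply: sumr_ge0 => i _; rewrite mxE; apply: sumr_ge0 => j _.
by rewrite mxE sqr_ge0.
Qed.

Lemma mxtrace_conj_dyad_ge0 M v : M^T = M -> 0 <= \tr (M *m (v *m v^T) *m M).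
Proof.
move=> Msym; have := mxtrace_mul_tr_ge0 (M *m v).
by rewrite trmx_mul Msym !mulmxA.
Qed.

Lemma mxtrace_inv_add_dyad M v (c : R) : M \in unitmx ->
  1 + c * \tr (invmx M *m (v *m v^T)) != 0 ->
  \tr (invmx (M + c *: (v *m v^T))) = \tr (invmx M) -
    c / (1 + c * \tr (invmx M *m (v *m v^T))) * \tr (invmx M *m (v *m v^T) *m invmx M).
Proof. by move=> Mu s0; rewrite sherman_morrison // raddfB /= mxtraceZ. Qed.

(** Dyads are added one at a time; each subtracts a nonnegative multiple of [\tr (N^-1 v v^T N^-1)],
    a squared norm. *)
Lemma le_mxtrace_inv_add_dyads (I : Type) (r : seq I) (P : pred I) (a : I -> 'cV[R]_d)
    (c : I -> R) M :
  (forall i, P i -> 0 <= c i) -> posdef M ->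
  \tr (invmx (M + \sum_(i <- r | P i) c i *: (a i *m (a i)^T))) <= \tr (invmx M).
Proof.
move=> c0 Mpd; elim: r => [|i r IHr]; first by rewrite big_nil addr0.
rewrite big_cons; case: ifP => // Pi; apply: le_trans IHr.
rewrite addrCA addrC; set N := M + _.
have Npd : posdef N by exact: posdef_add_dyads.
have s0 : 0 <= c i * \tr (invmx N *m (a i *m (a i)^T)).
  by rewrite mulr_ge0 ?c0 // posdef_ge0 //; exact: posdef_inv.
have s1 : 0 < 1 + c i * \tr (invmx N *m (a i *m (a i)^T)) by rewrite ltr_wpDr.
rewrite mxtrace_inv_add_dyad ?gt_eqF ?posdef_unit // gerBl.
have [Nsym _] := posdef_inv Npd.
by rewrite mulr_ge0 ?mxtrace_conj_dyad_ge0 // divr_ge0 ?c0 // ltW.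
Qed.

(** For [v != 0], testing [M - v v^T] at [M^-1 v] gives [s - s^2 > 0], where [s > 0] is the
    leverage. *)
Lemma leverage_lt1 M v : posdef M -> posdef (M - v *m v^T) ->
  \tr (invmx M *m (v *m v^T)) < 1.
Proof.
move=> Mpd [_ Dpos]; have Mu := posdef_unit Mpd; have [Vsym Vpos] := posdef_inv Mpd.
have [->|v0] := eqVneq v 0; first by rewrite mul0mx mulmx0 mxtrace0 ltr01.
have s0 := Vpos _ v0; set s := \tr _ in s0 *.
have w0 : invmx M *m v != 0.
  by apply: contraNneq v0 => w0; rewrite -(mulKVmx Mu v) w0 mulmx0.
have vVv : v^T *m invmx M *m v = s%:M by rewrite [LHS]mx11_scalar /s mxtrace_dyad.
have := Dpos _ w0; rewrite mxtrace_dyad trmx_mul Vsym mulmxBr mulmxBl.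
rewrite -[_ *m _ *m M]mulmxA mulVmx // mulmx1 mulmxA vVv.
rewrite [v^T *m invmx M *m _]mulmxA vVv -mulmxA [v^T *m _]mulmxA vVv -scalar_mxM.
rewrite -raddfB mxE mulr1n -{1}[s]mulr1 -mulrBr pmulr_rgt0 //.
by rewrite subr_gt0.
Qed.

End TraceOfInverse.

(** * Removing indices one at a time from the full design *)

Section BackwardGreedy.
Context {R : realFieldType} {d n : nat}.
Variables (a : 'I_n -> 'cV[R]_d) (lambda : R).
Hypotheses (d_gt0 : (0 < d)%N) (lambda_gt0 : 0 < lambda).

(** [design] and [subdesign] repeat the matrices inside [nukC] and [zk], so that both values unfold
    to traces of their inverses. *)
Definition design (x : 'I_n -> R) := \sum_(i < n) x i *: (a i *m (a i)^T) + lambda%:M.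

Definition subdesign (S : {set 'I_n}) := \sum_(i in S) a i *m (a i)^T + lambda%:M.

Lemma subdesign_indicator S : subdesign S = design (fun i => (i \in S)%:R).
Proof.
rewrite /subdesign /design big_mkcond /=; congr (_ + _); apply: eq_bigr => i _.
by case: (i \in S); rewrite ?scale1r ?scale0r.
Qed.

Lemma posdef_design x : (forall i, 0 <= x i) -> posdef (design x).
Proof.
move=> x0; rewrite /design addrC; apply: posdef_add_dyads => //.
exact: posdef_scalar.
Qed.

Lemma posdef_subdesign S : posdef (subdesign S).
Proof. by rewrite subdesign_indicator; apply: posdef_design => i; rewrite ler0n. Qed.

Lemma mxtrace_inv_design_gt0 x : (forall i, 0 <= x i) -> 0 < \tr (invmx (design x)).
Proof. by move=> x0; apply/mxtrace_posdef_gt0/posdef_inv/posdef_design. Qed.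

Lemma mxtrace_inv_design_anti x y : (forall i, 0 <= x i <= y i) ->
  \tr (invmx (design y)) <= \tr (invmx (design x)).
Proof.
move=> xy; have -> : design y = design x + \sum_(i < n) (y i - x i) *: (a i *m (a i)^T).
  rewrite /design addrAC -big_split /=; congr (_ + _); apply: eq_bigr => i _.
  by rewrite -scalerDl addrC subrK.
apply: le_mxtrace_inv_add_dyads => [i _|].
  by have /andP[_] := xy i; rewrite subr_ge0.
by apply: posdef_design => i; have /andP[] := xy i.
Qed.

Lemma subdesignD1 (S : {set 'I_n}) i : i \in S ->
  subdesign (S :\ i)%SET = subdesign S - a i *m (a i)^T.
Proof. by move=> iS; rewrite /subdesign (big_setD1 i iS) /= -(addrA (a i *m _)) [RHS]addrC addKr. Qed.

(* Weight the removal of [i] by [w i = 1 - a_i^T M^-1 a_i], so that the denominators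
   of the Sherman-Morrison formula cancel; the weights add up to at least [#|S| - d]. *)
Lemma removal_step (S : {set 'I_n}) : (d < #|S|)%N ->
  exists2 i, i \in S &
    (#|S|%:R - d%:R) * \tr (invmx (subdesign (S :\ i)%SET)) <=
    (#|S|%:R - d%:R + 1) * \tr (invmx (subdesign S)).
Proof.
move=> dS; set M := subdesign S; set T := \tr (invmx M); set m := _ - _.
have Mpd : posdef M by exact: posdef_subdesign.
have Mu := posdef_unit Mpd; have [Vsym _] := posdef_inv Mpd.
have m0 : 0 < m by rewrite subr_gt0 ltr_nat.
have T0 : 0 < T by apply: mxtrace_posdef_gt0 => //; exact: posdef_inv.
pose s i := \tr (invmx M *m (a i *m (a i)^T)).
pose u i := \tr (invmx M *m (a i *m (a i)^T) *m invmx M).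
pose t i := \tr (invmx (subdesign (S :\ i)%SET)).
have sumA : \sum_(i in S) a i *m (a i)^T = M - lambda%:M by rewrite addrK.
(* The [lambda] term keeps the matrix positive definite after the removal of [i]. *)
have w0 i : i \in S -> 0 < 1 - s i.
  move=> iS; rewrite subr_gt0; apply: leverage_lt1 => //.
  by rewrite -subdesignD1 //; exact: posdef_subdesign.
have wt i : i \in S -> (1 - s i) * t i = (1 - s i) * T + u i.
  move=> iS; have wn0 : 1 - s i != 0 by rewrite gt_eqF ?w0.
  have -> : t i = T + (1 - s i)^-1 * u i.
    rewrite /t subdesignD1 // -scaleN1r mxtrace_inv_add_dyad ?mulN1r //.
    by rewrite mulNr opprK.
  by rewrite mulrDr mulVKf.
(* The leverages add up to [\tr (M^-1 (M - lambda I)) = d - lambda T]. *)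
have sumw : \sum_(i in S) (1 - s i) = m + lambda * T.
  rewrite sumrB sumr_const -raddf_sum -mulmx_sumr sumA mulmxBr mulVmx //.
  by rewrite mul_mx_scalar raddfB /= mxtraceZ mxtrace_scalar opprB addrA addrAC.
(* The sum equals [T - lambda \tr (M^-2)]. *)
have sumu : \sum_(i in S) u i <= T.
  rewrite -raddf_sum -mulmx_suml -mulmx_sumr sumA mulmxBr mulVmx //.
  rewrite mulmxBl mul1mx mul_mx_scalar -scalemxAl raddfB /= mxtraceZ gerBl.
  by rewrite mulr_ge0 ?(ltW lambda_gt0) // -{2}Vsym mxtrace_mul_tr_ge0.
have [//|none] := pselect (exists2 i, i \in S & m * t i <= (m + 1) * T).
have lt_t i : i \in S -> (m + 1) * T < m * t i.
  by move=> iS; rewrite ltNge; apply/negP => le_t; apply: none; exists i.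
have : \sum_(i in S) (1 - s i) * ((m + 1) * T) <= \sum_(i in S) (1 - s i) * (m * t i).
  by apply: ler_sum => i iS; rewrite ler_wpM2l // ltW ?w0 ?lt_t.
under [leRHS]eq_bigr => i iS do rewrite mulrCA wt //.
rewrite -mulr_suml sumw -mulr_sumr big_split /= -mulr_suml sumw.
have lT : 0 < lambda * T by rewrite mulr_gt0.
(* Bounding the sum of the [u i] by [T] leaves [lambda * T ^ 2 <= 0], which is absurd. *)
nra.
Qed.

(** Induction on the number [m] of removals; in product form the factors telescope without
    division. *)
Lemma backward_greedy m k : (d <= k)%N -> (k + m = n)%N ->
  exists2 S : {set 'I_n}, #|S| = k &
    (k%:R - d%:R + 1) * \tr (invmx (subdesign S)) <=
    (n%:R - d%:R + 1) * \tr (invmx (subdesign [set: 'I_n]%SET)).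
Proof.
elim: m k => [|m IHm] k dk kmn.
  have -> : k = n by rewrite -kmn addn0.
  by exists [set: 'I_n]%SET; rewrite ?cardsT ?card_ord.
have [||S Sk leS] := IHm k.+1; rewrite ?addSnnS ?leqW //.
have [|i iS leSi] := @removal_step S; first by rewrite Sk.
exists (S :\ i)%SET; first by have := cardsD1 i S; rewrite iS Sk => -[].
apply: le_trans leS; move: leSi; rewrite Sk -natr1.
(* The left factor of a removal from size [k + 1] is the factor required at size [k]. *)
by have -> : k%:R + 1 - d%:R = k%:R - d%:R + 1 :> R by ring.
Qed.

End BackwardGreedy.

(** * Existence of the minima *)

Section Attainment.
Context {R : realType}.

Lemma minimumP (A : set R) : (exists m, A m /\ lbound A m) ->
  A (minimum A) /\ lbound A (minimum A).
Proof. exact: (@xgetPex _ 0 [set m | A m /\ lbound A m]). Qed.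

(** A minimizer rules out the default value 0 of [minimum]. *)
Lemma minimum_image (T : Type) (A : set T) (f : T -> R) :
  (exists2 x, A x & forall y, A y -> f x <= f y) ->
  exists x, [/\ A x, minimum [set f x | x in A] = f x & forall y, A y -> f x <= f y].
Proof.
move=> [x Ax fx]; have [|[y Ay fy] lb] := @minimumP [set f x | x in A].
  by exists (f x); split=> [|_ [y Ay <-]]; [exists x | exact: fx].
by exists y; split=> // z Az; rewrite fy; apply: lb; exists z.
Qed.

Lemma continuous_sum {T : topologicalType} {I : Type} {r : seq I} {f : I -> T -> R} :
  (forall i, continuous (f i)) -> continuous (fun x => \sum_(i <- r) f i x).
Proof.
move=> fcont x; apply: (@cvg_big R^o _ _ _ _ add_continuous _ (nbhs x)) => i _.
exact: fcont.
Qed.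

Lemma continuous_det {T : topologicalType} {d : nat} (M : T -> 'M[R]_d) :
  (forall i j, continuous (fun t => M t i j)) -> continuous (fun t => \det (M t)).
Proof.
move=> Mcont; apply: continuous_sum => s x.
have prod_cvg : \prod_i M t i (s i) @[t --> x] --> \prod_i M x i (s i).
  apply: (@cvg_big R^o _ _ _ _ mul_continuous _ (nbhs x)) => i _.
  exact: Mcont.
exact: (cvgM (cvg_cst _) prod_cvg).
Qed.

(** The adjugate formula gives a quotient of polynomials in the entries, from which continuity can
    be read off. *)
Lemma mxtrace_invE {d : nat} {M : 'M[R]_d} : M \in unitmx ->
  \tr (invmx M) = (\det M)^-1 * \sum_(i < d) cofactor M i i.
Proof.
move=> Mu; rewrite /invmx Mu mxtraceZ; congr (_ * _).
by apply: eq_bigr => i _; rewrite mxE.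
Qed.

Context {d n : nat}.
Variables (a : 'I_n -> 'cV[R]_d) (lambda : R).
Hypothesis lambda_gt0 : 0 < lambda.

Lemma continuous_design_entry i j :
  continuous (fun x : 'rV[R]_n => design a lambda (x 0) i j).
Proof.
rewrite (_ : (fun x : 'rV[R]_n => _) = fun x =>
    \sum_(l < n) x 0 l * (a l *m (a l)^T) i j + lambda%:M i j); last first.
  apply/funext => x; rewrite /design mxE summxE.
  by under eq_bigr do rewrite mxE.
have sum_cont : continuous (fun x : 'rV[R]_n => \sum_(l < n) x 0 l * (a l *m (a l)^T) i j).
  apply: continuous_sum => l x; exact: (cvgM (@coord_continuous _ _ _ 0 l x) (cvg_cst _)).
by move=> x; exact: (cvgD (sum_cont x) (cvg_cst _)).
Qed.

(** The feasible set is the unit cube cut by a hyperplane, hence compact, and the extreme value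
    theorem applies. *)
Lemma mxtrace_inv_design_attains_min (k : R) :
  (exists x : 'rV[R]_n, (forall i, 0 <= x 0 i <= 1) /\ \sum_(i < n) x 0 i = k) ->
  exists2 x : 'rV[R]_n, (forall i, 0 <= x 0 i <= 1) /\ \sum_(i < n) x 0 i = k &
    forall y : 'rV[R]_n, (forall i, 0 <= y 0 i <= 1) /\ \sum_(i < n) y 0 i = k ->
    \tr (invmx (design a lambda (x 0))) <= \tr (invmx (design a lambda (y 0))).
Proof.
pose A := [set x : 'rV[R]_n | (forall i, 0 <= x 0 i <= 1) /\ \sum_(i < n) x 0 i = k].
move=> A0; have Au x : A x -> design a lambda (x 0) \in unitmx.
  by move=> [x01 _]; apply/posdef_unit/posdef_design => // i; have /andP[] := x01 i.
(* [f] is the objective in cofactor form; it agrees with the trace on [A], where the design is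
   invertible. *)
pose f (x : 'rV[R]_n) := (\det (design a lambda (x 0)))^-1 *
  \sum_(i < d) cofactor (design a lambda (x 0)) i i.
have Acompact : compact A.
  apply: compact_closedI.
    have := @rV_compact R n (fun=> [set` `[0, 1]]) (fun=> @segment_compact R 0 1).
    by congr compact; apply/seteqP; split=> x /= x01 i; have := x01 i; rewrite in_itv.
  apply: (@preimage_closed _ _ (fun x : 'rV[R]_n => \sum_(i < n) x 0 i) [set k]).
    by move=> x _; apply: continuous_sum => l; exact: coord_continuous.
  exact: closed_eq.
have fcont : {within A, continuous f}.
  apply: continuous_in_subspaceT => x /set_mem Ax.
  have det_cont : continuous (fun y : 'rV[R]_n => \det (design a lambda (y 0))).
    by apply: continuous_det; exact: continuous_design_entry.
  have det_neq0 : \det (design a lambda (x 0)) != 0.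
    by have := Au x Ax; rewrite unitmxE unitfE.
  have cofactor_cont i j : continuous (fun y : 'rV[R]_n => cofactor (design a lambda (y 0)) i j).
    have minor_cont : continuous (fun y : 'rV[R]_n =>
        \det (row' i (col' j (design a lambda (y 0))))).
      apply: continuous_det => p q; rewrite (_ : (fun t : 'rV[R]_n => _) = fun t =>
        design a lambda (t 0) (lift i p) (lift j q)).
        exact: continuous_design_entry.
      by apply/funext => t; rewrite !mxE.
    by move=> y; exact: (cvgM (cvg_cst _) (minor_cont y)).
  have trace_cont := continuous_sum (fun i => cofactor_cont i i).
  exact: (cvgM (cvgV det_neq0 (det_cont x)) (trace_cont _ x)).
have [x /set_mem Ax fx] := EVT_min_rV A0 Acompact fcont.
exists x => // y Ay; rewrite !mxtrace_invE ?Au //.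
by apply: fx; rewrite inE.
Qed.

End Attainment.

(** * The two optimal values and the inequalities between them *)

Section Values.
Context {R : realType} {d n : nat}.
Variables (a : 'I_n -> 'cV[R]_d) (lambda : R) (k : nat).
Hypotheses (lambda_gt0 : 0 < lambda) (le_kn : (k <= n)%N).

(** There are finitely many [k]-subsets, and at least one because [k <= n]. *)
Lemma zk_attained : exists S : {set 'I_n}, [/\ #|S| = k,
  zk a lambda k = \tr (invmx (subdesign a lambda S)) &
  forall S' : {set 'I_n}, #|S'| = k ->
    \tr (invmx (subdesign a lambda S)) <= \tr (invmx (subdesign a lambda S'))].
Proof.
apply: (@minimum_image _ _ [set S : {set 'I_n} | #|S| = k]
  (fun S => \tr (invmx (subdesign a lambda S)))).
have : (0 < #|[set S : {set 'I_n} | #|S| == k]%SET|)%N.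
  by rewrite card_draws card_ord bin_gt0.
case/card_gt0P => S0; rewrite inE => S0k.
pose f (S : {set 'I_n}) := \tr (invmx (subdesign a lambda S)).
have [S Sk Smin] := @arg_minP _ _ _ S0 (fun S : {set 'I_n} => #|S| == k) f S0k.
by exists S => [|S' S'k]; [exact/eqP | apply: Smin; exact/eqP].
Qed.

Definition indicator (S : {set 'I_n}) : 'rV[R]_n := \row_i (i \in S)%:R.

Lemma design_indicator S : design a lambda (indicator S 0) = subdesign a lambda S.
Proof.
rewrite subdesign_indicator; congr (_ + _).
by apply: eq_bigr => i _; rewrite mxE.
Qed.

Lemma indicator_feasible (S : {set 'I_n}) : #|S| = k ->
  (forall i, 0 <= indicator S 0 i <= 1) /\ \sum_(i < n) indicator S 0 i = k%:R.
Proof.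
move=> Sk; split=> [i|]; first by rewrite mxE; case: (i \in S); rewrite ?lexx ?ler01.
under eq_bigr do rewrite mxE.
by rewrite -natr_sum -Sk -sum1_card [in RHS]big_mkcond.
Qed.

Lemma nukC_attained : exists x : 'rV[R]_n,
  [/\ (forall i, 0 <= x 0 i <= 1) /\ \sum_(i < n) x 0 i = k%:R,
  nukC a lambda k = \tr (invmx (design a lambda (x 0))) &
  forall y : 'rV[R]_n, (forall i, 0 <= y 0 i <= 1) /\ \sum_(i < n) y 0 i = k%:R ->
    \tr (invmx (design a lambda (x 0))) <= \tr (invmx (design a lambda (y 0)))].
Proof.
apply: (@minimum_image _ _ [set x : 'rV[R]_n |
    (forall i, 0 <= x 0 i <= 1) /\ \sum_(i < n) x 0 i = k%:R]
  (fun x => \tr (invmx (design a lambda (x 0))))).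
apply: mxtrace_inv_design_attains_min => //.
have [S [Sk _ _]] := zk_attained.
by exists (indicator S); exact: indicator_feasible.
Qed.

Hypothesis d_gt0 : (0 < d)%N.

Lemma nukC_gt0 : 0 < nukC a lambda k.
Proof.
have [x [[x01 _] -> _]] := nukC_attained.
by apply: mxtrace_inv_design_gt0 => // i; have /andP[] := x01 i.
Qed.

(** The indicator of an optimal [k]-subset is feasible for the relaxation. *)
Lemma nukC_le_zk : nukC a lambda k <= zk a lambda k.
Proof.
have [x [_ -> xmin]] := nukC_attained; have [S [Sk -> _]] := zk_attained.
by rewrite -design_indicator; apply: xmin; exact: indicator_feasible.
Qed.

(** The greedy set links [zk] to the full design, whose value is at most [nukC]. *)
Lemma zk_le_nukC : (d <= k)%N ->
  (k%:R - d%:R + 1) * zk a lambda k <= (n%:R - d%:R + 1) * nukC a lambda k.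
Proof.
move=> dk; have [S [Sk -> Smin]] := zk_attained; have [x [[x01 _] -> _]] := nukC_attained.
have [S' S'k leS'] := backward_greedy a lambda d_gt0 lambda_gt0 _ _ dk (subnKC le_kn).
have dkR : d%:R <= k%:R :> R by rewrite ler_nat.
have knR : k%:R <= n%:R :> R by rewrite ler_nat.
apply: (le_trans (ler_wpM2l _ (Smin _ S'k))); first by lra.
apply: (le_trans leS'); rewrite ler_wpM2l //; first by lra.
(* The full design is the all-ones point, which dominates every feasible [x]. *)
rewrite subdesign_indicator; apply: mxtrace_inv_design_anti => // i.
by rewrite inE; exact: x01.
Qed.

End Values.

(** * The standard basis instance, with diagonal design matrices *)

Section OrthonormalInstance.
Context {R : realType} {d : nat}.

Definition basis_vector (i : 'I_d) : 'cV[R]_d := delta_mx i 0.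

Lemma design_basis (lambda : R) (x : 'I_d -> R) :
  design basis_vector lambda x = diag_mx (\row_i (x i + lambda)).
Proof.
rewrite /design; apply/matrixP => p q; rewrite !mxE summxE.
rewrite (bigD1 p) //= big1 => [|i /negPf ip]; last first.
  by rewrite /basis_vector trmx_delta mul_delta_mx !mxE eq_sym ip mulr0.
rewrite /basis_vector trmx_delta mul_delta_mx !mxE eqxx addr0 [q == p]eq_sym.
by case: (p == q); rewrite ?mulr1n ?mulr0n ?mulr1 // mulr0 addr0.
Qed.

Lemma mxtrace_inv_design_basis (lambda : R) (x : 'I_d -> R) :
  (forall i, x i + lambda != 0) ->
  \tr (invmx (design basis_vector lambda x)) = \sum_(i < d) (x i + lambda)^-1.
Proof.
move=> xl0; rewrite design_basis; set D := diag_mx _.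
have DD : D *m diag_mx (\row_i (x i + lambda)^-1) = 1%:M.
  rewrite mulmx_diag -diag_const_mx; congr diag_mx; apply/rowP => i.
  by rewrite !mxE divff.
have [Du _] := mulmx1_unit DD.
rewrite -[invmx D]mulmx1 -DD mulKmx // mxtrace_diag.
by apply: eq_bigr => i _; rewrite mxE.
Qed.

Lemma zk_basis_ge (lambda : R) (k : nat) : 0 < lambda -> (k < d)%N ->
  lambda^-1 <= zk basis_vector lambda k.
Proof.
move=> l0 kd; have [S [Sk -> _]] := zk_attained basis_vector lambda k (ltnW kd).
have Sl0 i : 0 < (i \in S)%:R + lambda by rewrite ltr_wpDl.
rewrite subdesign_indicator mxtrace_inv_design_basis => [|i]; last by rewrite gt_eqF.
(* An index missed by [S] contributes [lambda^-1] to the trace. *)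
have [i iS] : exists i, i \notin S.
  apply/existsP; apply: contraTT kd; rewrite negb_exists => /forallP SA.
  have -> : k = d; last by rewrite ltnn.
  rewrite -Sk -[RHS]card_ord -cardsT; congr #|pred_of_set _|.
  by apply/setP => i; rewrite inE; have := SA i; rewrite negbK.
rewrite (bigD1 i) //= (negPf iS) add0r lerDl.
by apply: sumr_ge0 => j _; rewrite invr_ge0 ltW.
Qed.

Lemma nukC_basis_le (lambda : R) (k : nat) : 0 < lambda -> (0 < k <= d)%N ->
  nukC basis_vector lambda k <= d%:R ^+ 2 / k%:R.
Proof.
move=> l0 /andP[k0 kd]; have [x [_ -> xmin]] := nukC_attained basis_vector lambda k l0 kd.
have k0R : 0 < k%:R :> R by rewrite ltr0n.
have d0R : 0 < d%:R :> R by rewrite ltr0n (leq_trans k0).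
have kdR : k%:R <= d%:R :> R by rewrite ler_nat.
(* The uniform point has value [d / (k / d + lambda)]; dropping [lambda] gives the bound. *)
pose y : 'rV[R]_d := const_mx (k%:R / d%:R).
have yl0 : 0 < k%:R / d%:R + lambda by rewrite addr_gt0 ?divr_gt0.
apply: (le_trans (xmin y _)).
  split=> [i|]; first by rewrite mxE divr_ge0 ?ler0n //= ler_pdivrMr // mul1r.
  under eq_bigr do rewrite mxE.
  by rewrite sumr_const card_ord -[LHS]mulr_natr divfK ?gt_eqF.
rewrite mxtrace_inv_design_basis => [|i]; last by rewrite mxE gt_eqF.
under eq_bigr do rewrite mxE.
rewrite sumr_const card_ord -[leLHS]mulr_natr mulrC expr2 -mulrA ler_wpM2l ?ler0n //.
by rewrite -[leRHS]invf_div lef_pV2 ?posrE ?divr_gt0 // lerDl ltW.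
Qed.

Lemma ratio_basis_ge (lambda : R) (k : nat) : 0 < lambda -> (0 < k < d)%N ->
  (k%:R / d%:R ^+ 2) / lambda <= zk basis_vector lambda k / nukC basis_vector lambda k.
Proof.
move=> l0 /andP[k0 kd]; have d0 := leq_trans k0 (ltnW kd).
rewrite mulrC ler_pM ?invr_ge0 ?divr_ge0 ?exprn_ge0 ?ler0n ?(ltW l0) ?zk_basis_ge //.
rewrite -invf_div lef_pV2 ?posrE ?nukC_gt0 ?(ltnW kd) //.
  by rewrite nukC_basis_le // k0 ltnW.
by rewrite divr_gt0 ?exprn_gt0 ?ltr0n.
Qed.

End OrthonormalInstance.

Theorem theorem2 (R : realType) :
  (forall (d n k : nat) (a : 'I_n -> 'cV[R]_d) (lambda : R),
     (0 < d)%N -> (d <= n)%N -> (d <= k <= n)%N -> 0 < lambda ->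
     1 <= zk a lambda k / nukC a lambda k
       <= (n%:R - d%:R + 1) / (k%:R - d%:R + 1))
  /\
  (forall d k : nat, (0 < d)%N -> (1 <= k <= d - 1)%N ->
     exists (n : nat) (a : 'I_n -> 'cV[R]_d),
       (d <= n)%N /\
       zk a lambda k / nukC a lambda k @[lambda --> 0^'+] --> +oo).
Proof.
split=> [d n k a lambda d0 dn /andP[dk kn] l0 | d k d0 /andP[k0 kd1]].
  (* Positivity of the relaxation allows clearing denominators. *)
  have nu0 := nukC_gt0 a lambda k l0 kn d0.
  have dkR : d%:R <= k%:R :> R by rewrite ler_nat.
  rewrite ler_pdivlMr // mul1r nukC_le_zk //= ler_pdivrMr // mulrAC.
  rewrite ler_pdivlMr; last by lra.
  by rewrite mulrC zk_le_nukC.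
(* [0 < d] makes the truncated [d - 1] a true predecessor. *)
have kd : (k < d)%N by rewrite subn1 in kd1; rewrite -(prednK d0) ltnS.
exists d, basis_vector; split=> //.
apply/cvgryPge => A.
have c0 : 0 < k%:R / d%:R ^+ 2 :> R by rewrite divr_gt0 ?exprn_gt0 ?ltr0n.
(* A positive number above [A] can be divided by: every positive [lambda] up to
   [(k / d^2) / (|A| + 1)] works. *)
have A0 : 0 < `|A| + 1 :> R by rewrite ltr_wpDl.
near=> lambda; have l0 : 0 < lambda by near: lambda; exact: nbhs_right_gt.
apply: le_trans (ratio_basis_ge _ _ l0 _); last by rewrite k0.
rewrite ler_pdivlMr //; apply: (@le_trans _ _ ((`|A| + 1) * lambda)).
  by rewrite ler_wpM2r ?(ltW l0) // (le_trans (ler_norm A)) // lerDl.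
rewrite mulrC -ler_pdivlMr //; near: lambda.
by apply: nbhs_right_le; rewrite divr_gt0.
Unshelve. all: by end_near.
Qed.
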